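(* Let $k\ge 1$ and let $G=(V\cup\{m\},E)$ and $G'=(V'\cup\{m'\},E')$ be two graphs with disjoint vertex sets. If $G$ and $G'$ are both $k$-word-representable, then the split recomposition $G\ast G'$ (with marked vertices $m$ and $m'$) is $k$-word-representable.
   Context: All graphs are finite, simple and connected. A word over an alphabet is a finite sequence of letters; for a word $w$ and a set $B$ of letters, $w_B$ denotes the subword of $w$ consisting of all occurrences of letters of $B$. Two letters $a,b$ alternate in $w$ if $w_{\{a,b\}}$ is of the form $abab\cdots$ or $baba\cdots$ (of even or odd length). A graph $G=(V,E)$ is word-representable if there is a word $w$ over $V$ (containing every vertex) such that for all distinct $a,b\in V$, $a$ and $b$ are adjacent iff they alternate in $w$. A word is $k$-uniform if each letter occurs exactly $k$ times; $G$ is $k$-word-representable if it is represented by a $k$-uniform word. Split recomposition: for graphs $G=(V\cup\{m\},E)$ and $G'=(V'\cup\{m'\},E')$ with disjoint vertex sets, $G\ast G'$ is the graph with vertex set $V\cup V'$ whose edges are the edges of the induced subgraph $G[V]$, the edges of $G'[V']$, and all edges $\overline{ab}$ with $a\in N_G(m)$ and $b\in N_{G'}(m')$ ($N$ denotes neighborhood). *)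

(* Defs.v *)
From HB Require Import structures.
From mathcomp Require Import all_boot.
Set Implicit Arguments.
Unset Strict Implicit.
Unset Printing Implicit Defensive.

Record sgraph := SGraph {
  vertex :> finType;
  adj : rel vertex;
  adj_sym : symmetric adj;
  adj_irrefl : irreflexive adj
}.

Definition neighborhood (G : sgraph) (x : G) : {set G} := [set y | adj x y].

Definition connected (G : sgraph) : Prop := forall x y : G, connect (@adj G) x y.

Definition subword (T : finType) (B : {set T}) (w : seq T) : seq T :=
  [seq x <- w | x \in B].

(* The word a b a b ... of length n. *)
Definition altword (T : Type) (a b : T) (n : nat) : seq T :=
  mkseq (fun i => if odd i then b else a) n.

Definition alternate (T : finType) (w : seq T) (a b : T) : Prop :=
  exists n, subword [set a; b] w = altword a b n
         \/ subword [set a; b] w = altword b a n.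

Definition represents (G : sgraph) (w : seq G) : Prop :=
  (forall x : G, x \in w) /\
  (forall a b : G, a != b -> (adj a b <-> alternate w a b)).

Definition uniform (T : eqType) (k : nat) (w : seq T) : Prop :=
  forall x : T, count_mem x w = k.

Definition k_word_representable (k : nat) (G : sgraph) : Prop :=
  exists w : seq G, uniform k w /\ represents w.

Section Recomposition.

Variables (G G' : sgraph) (m : G) (m' : G').

(* The vertex set is the tagged union of V = G \ {m} and V' = G' \ {m'}, so
   the vertex sets of G and G' need not be assumed disjoint. *)
Definition recomp_vertex : finType := ({x : G | x != m} + {y : G' | y != m'})%type.

Definition recomp_adj (u v : recomp_vertex) : bool :=
  match u, v with
  | inl a, inl b => adj (val a) (val b)
  | inr a, inr b => adj (val a) (val b)
  | inl a, inr b | inr b, inl a =>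
      (val a \in neighborhood m) && (val b \in neighborhood m')
  end.

Lemma recomp_adj_sym : symmetric recomp_adj.
Proof. by move=> [a|a] [b|b] //=; rewrite adj_sym. Qed.

Lemma recomp_adj_irrefl : irreflexive recomp_adj.
Proof. by move=> [a|a] /=; rewrite adj_irrefl. Qed.

Definition split_recomposition : sgraph :=
  SGraph recomp_adj_sym recomp_adj_irrefl.

End Recomposition.

(* Main.v *)
(* Rotating a uniform word preserves alternation, so we may write the words of
   G and G' as m A_1 m A_2 ... m A_k and m' B_1 m' B_2 ... m' B_k.  The word
   A_1 B_1 A_2 B_2 ... A_k B_k then represents the recomposition: inside V and
   inside V' nothing changes, and a letter a of V alternates with a letter b of
   V' exactly when a occurs once in every A_i and b once in every B_i, that is,
   when a is adjacent to m and b is adjacent to m'. *)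
Require Import Defs.
From mathcomp Require Import all_boot.

Set Implicit Arguments.
Unset Strict Implicit.
Unset Printing Implicit Defensive.

(* The trace of w on {a, b}, with true for a and false for b. *)
Definition code (T : eqType) (a b : T) (w : seq T) : seq bool :=
  [seq x == a | x <- w & (x == a) || (x == b)].

(** Linear alternation can be lost by rotating a word, as for [aba]. Closing the trace into a cycle
    makes the notion rotation invariant, at no cost when both letters have the same multiplicity. *)
Definition cyclic_alternate (T : eqType) (a b : T) (w : seq T) : bool :=
  cycle (fun x y => x != y) (code a b w).

(** * Alternating words and alternating boolean paths *)

Section Altword.

Lemma altwordS (T : Type) (a b : T) n :
  altword a b n.+1 = a :: altword b a n.
Proof.
rewrite /altword /mkseq /= (iotaDl 1 0) -map_comp; congr cons.
by apply: eq_map => i /=; case: (odd i).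
Qed.

Lemma altword_rcons (T : Type) (a b : T) n :
  altword a b n.+1 = rcons (altword a b n) (if odd n then b else a).
Proof. exact: mkseqS. Qed.

Lemma map_altword (T U : Type) (f : T -> U) (a b : T) n :
  map f (altword a b n) = altword (f a) (f b) n.
Proof. by elim: n a b => [|n IHn] a b //; rewrite !altwordS /= IHn. Qed.

Lemma path_altword (x : bool) n :
  path (fun x y => x != y) x (altword (~~ x) x n).
Proof.
elim: n x => [|n IHn] x //; rewrite altwordS /=.
by have := IHn (~~ x); rewrite negbK => ->; case: x.
Qed.

(** A boolean other than [x] can only be [~~ x], so the path is determined by its start and its
    length. *)
Lemma path_neq_altword (x : bool) s :
  path (fun x y => x != y) x s -> s = altword (~~ x) x (size s).
Proof.
elim: s x => [|y s IHs] x //= /andP[xy /IHs].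
have -> : y = ~~ x by case: x y xy => [] [].
by rewrite negbK altwordS => {1}->.
Qed.

(** Even length makes the last letter differ from the first, so the cycle closes up. *)
Lemma cycle_altword (x : bool) n :
  ~~ odd n -> cycle (fun x y => x != y) (altword x (~~ x) n).
Proof.
case: n => [|n] //; rewrite oddS negbK altwordS => n_odd.
rewrite /cycle; have -> : rcons (altword (~~ x) x n) x = altword (~~ x) x n.+1.
  by rewrite altword_rcons n_odd.
exact: path_altword.
Qed.

End Altword.

(** * Two-letter traces and cyclic alternation *)

Section Code.

Variable T : eqType.
Implicit Types (a b : T) (w : seq T).

Lemma code_cat a b w1 w2 : code a b (w1 ++ w2) = code a b w1 ++ code a b w2.
Proof. by rewrite /code filter_cat map_cat. Qed.

Lemma code_flatten a b ws : code a b (flatten ws) = flatten (map (code a b) ws).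
Proof. by elim: ws => //= w ws IHw; rewrite code_cat IHw. Qed.

Lemma size_code a b w :
  a != b -> size (code a b w) = count_mem a w + count_mem b w.
Proof.
move=> ab; rewrite size_map size_filter.
elim: w => //= x w ->; case: (eqVneq x a) => [->|_] /=.
  by rewrite (negbTE ab) add0n addnA.
by rewrite addnCA.
Qed.

Lemma code_absent_left a b w : a \notin w -> code a b w = nseq (count_mem b w) false.
Proof.
elim: w => //= x w IHw; rewrite inE negb_or eq_sym => /andP[xa /IHw].
by rewrite /code /= (negbTE xa); case: eqP => //= _ ->; rewrite (negbTE xa).
Qed.

Lemma code_absent_right a b w : b \notin w -> code a b w = nseq (count_mem a w) true.
Proof.
elim: w => //= x w IHw; rewrite inE negb_or eq_sym => /andP[xb /IHw].
by rewrite /code /= (negbTE xb) orbF; case: eqP => //= -> ->; rewrite eqxx.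
Qed.

Lemma code_cons_absent x a b w :
  a != x -> b != x -> code a b (x :: w) = code a b w.
Proof. by rewrite /code /= ![_ == x]eq_sym => /negbTE-> /negbTE->. Qed.

(** Rotating [w] rotates its trace, by the length of the trace of the prefix that moves to the
    end. *)
Lemma cyclic_alternate_rot a b i w :
  cyclic_alternate a b (rot i w) = cyclic_alternate a b w.
Proof.
rewrite -{2}(cat_take_drop i w) /cyclic_alternate /rot !code_cat.
by rewrite -[RHS](rot_cycle (size (code a b (take i w)))) rot_size_cat.
Qed.

End Code.

Lemma alternate_sym (T : finType) (w : seq T) a b :
  alternate w a b -> alternate w b a.
Proof. by rewrite /alternate setUC => -[n H]; exists n; case: H; [right|left]. Qed.

(* Equal multiplicities make the trace even, hence alternating cyclically. *)
Lemma alternateP (T : finType) (w : seq T) (a b : T) :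
  a != b -> count_mem a w = count_mem b w ->
  alternate w a b <-> cyclic_alternate a b w.
Proof.
move=> ab eq_count.
have codeE : code a b w = [seq x == a | x <- subword [set a; b] w].
  by rewrite /code /subword; congr map; apply: eq_filter => x; rewrite !inE.
(* The trace loses nothing: decoding its booleans recovers the subword. *)
have subwordE : subword [set a; b] w = [seq if x then a else b | x <- code a b w].
  rewrite codeE -map_comp -[LHS]map_id; apply/eq_in_map => x /=.
  by rewrite mem_filter !inE => /andP[/orP[]/eqP-> _]; rewrite ?eqxx // eq_sym (negbTE ab).
have even_code : ~~ odd (size (code a b w)).
  by rewrite size_code // eq_count addnn odd_double.
split=> [[n] alt | ].
  have ba : (b == a) = false by rewrite eq_sym (negbTE ab).
  have {}alt : code a b w = altword true false n \/ code a b w = altword false true n.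
    by rewrite codeE; case: alt => ->; [left|right]; rewrite map_altword eqxx ba.
  rewrite /cyclic_alternate; move: even_code.
  by case: alt => ->; rewrite size_mkseq => n_even; [apply: (@cycle_altword true)
                                                 |apply: (@cycle_altword false)].
rewrite /cyclic_alternate /alternate subwordE.
case: (code a b w) => [|x s]; first by exists 0; left.
rewrite /cycle rcons_path => /andP[/path_neq_altword -> _]; exists (size s).+1.
by case: x; rewrite -altwordS map_altword; [left|right].
Qed.

(** * Cyclic words made of runs of [true] and [false] *)

Section Blocks.

Lemma flatten_ones (ps : seq (nat * nat)) :
  all (pred1 (1, 1)) ps ->
  flatten [seq nseq p.1 true ++ nseq p.2 false | p <- ps]
    = altword true false (size ps).*2.
Proof. by elim: ps => //= p ps IHp /andP[/eqP-> /IHp]; rewrite doubleS !altwordS => ->. Qed.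

(** A run of length at least two contains equal neighbours. *)
Lemma sorted_blocks_le1 (ps : seq (nat * nat)) :
  sorted (fun x y : bool => x != y)
    (flatten [seq nseq p.1 true ++ nseq p.2 false | p <- ps]) ->
  all (fun p => (p.1 <= 1) && (p.2 <= 1)) ps.
Proof.
elim: ps => //= -[n p] ps IHp; rewrite -catA => /= H.
have [H1 /cat_sorted2[H2 /IHp->]] := cat_sorted2 H.
by rewrite andbT; case: n p H1 H2 {H} => [|[|n]] [|[|p]].
Qed.

(** A zero entry would force the remaining entries, each at most 1, to sum to more than their
    number. *)
Lemma sumn_size_all1 (s : seq nat) :
  all (fun n => n <= 1) s -> sumn s = size s -> all (pred1 1) s.
Proof.
have le_size t : all (fun n => n <= 1) t -> sumn t <= size t.
  by elim: t => //= n t IHt /andP[n1 /IHt]; rewrite -add1n; apply: leq_add.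
elim: s => //= n s IHs /andP[n1 s1]; case: n n1 => [|[|n]] //= _.
  by move=> E; have := le_size _ s1; rewrite -[sumn s]add0n E ltnn.
by rewrite add1n => -[]; apply: IHs.
Qed.

(** The combinatorial core. Alternation bounds every run by 1, and the two sums then leave no room
    for an empty run. Conversely, unit runs spell an alternating word of even length. *)
Lemma cycle_blocks (ps : seq (nat * nat)) :
  sumn (unzip1 ps) = size ps -> sumn (unzip2 ps) = size ps ->
  cycle (fun x y : bool => x != y)
    (flatten [seq nseq p.1 true ++ nseq p.2 false | p <- ps])
  = all (pred1 1) (unzip1 ps) && all (pred1 1) (unzip2 ps).
Proof.
move=> sum1 sum2; apply/idP/idP => [cyc | ones].
  have le1 : all (fun p => (p.1 <= 1) && (p.2 <= 1)) ps.
    apply: sorted_blocks_le1; case: (flatten _) cyc => //= x s.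
    by rewrite rcons_path => /andP[].
  by apply/andP; split; apply: sumn_size_all1; rewrite ?size_map // all_map;
     apply: sub_all le1 => p /andP[].
rewrite flatten_ones; first by apply: (@cycle_altword true); rewrite odd_double.
move: ones; rewrite !all_map -all_predI; apply: sub_all => -[n p] /=.
by move=> /andP[/eqP-> /eqP->].
Qed.

End Blocks.

(** * Cutting a word before each occurrence of [m] *)

Section Factorization.

Variables (T : eqType) (m : T).

Lemma factor_at_letter (w : seq T) :
  ohead w = Some m ->
  exists As, [/\ w = flatten (map (cons m) As), all (fun A => m \notin A) As
               & size As = count_mem m w].
Proof.
case: w => [|y w] //= [->]; rewrite eqxx.
elim: w => [|x w [As [wE AsN sz]]]; first by exists [:: [::]].
have [->|xm] := eqVneq x m.
  by exists ([::] :: As); split; rewrite //= -?wE // sz /= eqxx.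
(* There is a first factor since [m :: w] is nonempty; a letter other than [m] is prepended to
   it. *)
case: As wE AsN sz => //= A As [wE] /andP[AN AsN] sz.
exists ((x :: A) :: As); split => /=; first by rewrite wE.
  by rewrite inE negb_or eq_sym xm AN.
by rewrite sz (negbTE xm).
Qed.

Variables (As : seq (seq T)).
Hypothesis AsN : all (fun A => m \notin A) As.

Lemma count_factors x :
  x != m -> count_mem x (flatten (map (cons m) As)) = sumn (map (count_mem x) As).
Proof.
move=> xm; rewrite count_flatten -map_comp; congr sumn.
by apply: eq_map => A /=; rewrite eq_sym (negbTE xm).
Qed.

(** Each factor [m :: A] has trace one [true], then one [false] per occurrence of [x] in [A], so
    [cycle_blocks] applies. *)
Lemma cyclic_alternate_factors x :
  x != m -> sumn (map (count_mem x) As) = size As ->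
  cyclic_alternate m x (flatten (map (cons m) As))
  = all (pred1 1) (map (count_mem x) As).
Proof.
move=> xm sumAs.
pose ps := [seq (1, count_mem x A) | A <- As].
have ps1 : unzip1 ps = nseq (size As) 1.
  by rewrite /unzip1 -map_comp; elim: (As) => //= A s ->.
have ps2 : unzip2 ps = map (count_mem x) As by rewrite /unzip2 -map_comp.
have -> : all (pred1 1) (map (count_mem x) As)
        = all (pred1 1) (unzip1 ps) && all (pred1 1) (unzip2 ps).
  by rewrite ps1 ps2 all_nseq /= orbT.
rewrite -cycle_blocks ?ps1 ?ps2 ?size_map ?sumn_nseq ?mul1n //.
rewrite /cyclic_alternate code_flatten -!map_comp; congr (cycle _ (flatten _)).
apply/eq_in_map => A /(allP AsN) mA /=.
by rewrite -(code_absent_left _ mA) /code /= eqxx /= eqxx.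
Qed.

End Factorization.

(** The representing word is rotated to start at [m]; phrasing adjacency cyclically lets it survive
    this rotation. *)
Lemma factored_word (k : nat) (G : sgraph) (m : G) :
  k_word_representable k G ->
  exists As : seq (seq G),
    [/\ all (fun A => m \notin A) As,
        size As = k,
        forall x, x != m -> sumn (map (count_mem x) As) = k
      & forall a b, a != b ->
          adj a b = cyclic_alternate a b (flatten (map (cons m) As))].
Proof.
move=> [w [unif [mem_w repr]]].
have headE : ohead (rot (index m w) w) = Some m.
  by rewrite rot_index.
have [As [wE AsN sz]] := factor_at_letter headE.
have count_rot x : count_mem x (rot (index m w) w) = k.
  by rewrite (permP (permEl (perm_rot _ _))); apply: unif.
exists As; split=> // [|x xm|a b ab].
- by rewrite sz.
- by rewrite -(count_factors _ xm) -wE.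
rewrite -wE cyclic_alternate_rot; apply/idP/idP.
  by move=> /(repr _ _ ab) /(alternateP ab); apply; rewrite !unif.
by move=> H; apply/(repr _ _ ab)/(alternateP ab) => //; rewrite !unif.
Qed.

(** * Counts and traces under a partial relabelling *)

Section Pmap.

Variables (T U : eqType) (f : T -> option U).

Lemma count_pmap (u : U) x s :
  (forall t, (f t == Some u) = (t == x)) ->
  count_mem u (pmap f s) = count_mem x s.
Proof.
move=> fu; elim: s => //= t s <-; rewrite -fu.
by case: (f t).
Qed.

Lemma notin_pmap (u : U) s : (forall t, f t != Some u) -> u \notin pmap f s.
Proof.
by move=> fu; rewrite mem_pmap; apply/mapP => -[t _ E]; have := fu t; rewrite -E eqxx.
Qed.

Lemma code_pmap (u v : U) x y s :
  (forall t, (f t == Some u) = (t == x)) ->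
  (forall t, (f t == Some v) = (t == y)) ->
  code u v (pmap f s) = code x y s.
Proof.
move=> fu fv; elim: s => //= t s; rewrite /code /= -fu -fv.
case ft: (f t) => [z|] //= IHs; rewrite -![Some z == _]/(z == _).
by case: ifP => //= _; rewrite IHs -fu ft.
Qed.

End Pmap.

(** * The interleaved word and its traces *)

Section Interleaving.

Variables (G G' : sgraph) (m : G) (m' : G').

Notation V := (recomp_vertex m m').

(** Undefined exactly at [m], so that [pmap] transfers a factor without a proof that it avoids
    [m]. *)
Definition left_letter (x : G) : option V := omap inl (insub x).
Definition right_letter (y : G') : option V := omap inr (insub y).

(** [zip] stops at the shorter list, hence the assumption [sizeAB] below. *)
Definition interleave (As : seq (seq G)) (Bs : seq (seq G')) : seq V :=
  flatten [seq pmap left_letter p.1 ++ pmap right_letter p.2 | p <- zip As Bs].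

Lemma left_letterE (a : {x : G | x != m}) t :
  (left_letter t == Some (inl a)) = (t == val a).
Proof.
rewrite /left_letter; case: insubP => [u _ <-|tm] /=; first by [].
by apply/esym/negbTE; apply: contraNneq tm => ->; apply: (valP a).
Qed.

Lemma right_letterE (b : {y : G' | y != m'}) t :
  (right_letter t == Some (inr b)) = (t == val b).
Proof.
rewrite /right_letter; case: insubP => [u _ <-|tm] /=; first by [].
by apply/esym/negbTE; apply: contraNneq tm => ->; apply: (valP b).
Qed.

Lemma notin_left (b : {y : G' | y != m'}) A : inr b \notin pmap left_letter A.
Proof. by apply: notin_pmap => t; rewrite /left_letter; case: insubP. Qed.

Lemma notin_right (a : {x : G | x != m}) B : inl a \notin pmap right_letter B.
Proof. by apply: notin_pmap => t; rewrite /right_letter; case: insubP. Qed.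

Variables (As : seq (seq G)) (Bs : seq (seq G')).
Hypothesis sizeAB : size As = size Bs.

Lemma map_zip_left (U : Type) (h : seq G -> U) :
  [seq h p.1 | p <- zip As Bs] = map h As.
Proof. by rewrite (map_comp h fst) -/unzip1 unzip1_zip ?sizeAB. Qed.

Lemma map_zip_right (U : Type) (h : seq G' -> U) :
  [seq h p.2 | p <- zip As Bs] = map h Bs.
Proof. by rewrite (map_comp h snd) -/unzip2 unzip2_zip ?sizeAB. Qed.

Lemma count_interleave_left (a : {x : G | x != m}) :
  count_mem (inl a) (interleave As Bs) = sumn (map (count_mem (val a)) As).
Proof.
rewrite count_flatten -map_comp -map_zip_left; congr sumn; apply: eq_map => p /=.
by rewrite count_cat (count_pmap _ (left_letterE a)) (count_memPn (notin_right _ _)) addn0.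
Qed.

Lemma count_interleave_right (b : {y : G' | y != m'}) :
  count_mem (inr b) (interleave As Bs) = sumn (map (count_mem (val b)) Bs).
Proof.
rewrite count_flatten -map_comp -map_zip_right; congr sumn; apply: eq_map => p /=.
by rewrite count_cat (count_pmap _ (right_letterE b)) (count_memPn (notin_left _ _)).
Qed.

(** Neither the inserted letters of [G'] nor the deleted copies of [m] contribute to this trace. *)
Lemma code_interleave_left (a b : {x : G | x != m}) :
  code (inl a) (inl b) (interleave As Bs)
  = code (val a) (val b) (flatten (map (cons m) As)).
Proof.
rewrite !code_flatten -!map_comp -map_zip_left; congr flatten; apply: eq_map => p /=.
rewrite code_cat (code_pmap _ (left_letterE a) (left_letterE b)).
rewrite (code_absent_left _ (notin_right a _)) (count_memPn (notin_right b _)) cats0.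
by rewrite code_cons_absent ?(valP a) ?(valP b).
Qed.

Lemma code_interleave_right (a b : {y : G' | y != m'}) :
  code (inr a) (inr b) (interleave As Bs)
  = code (val a) (val b) (flatten (map (cons m') Bs)).
Proof.
rewrite !code_flatten -!map_comp -map_zip_right; congr flatten; apply: eq_map => p /=.
rewrite code_cat (code_pmap _ (right_letterE a) (right_letterE b)).
rewrite (code_absent_left _ (notin_left a _)) (count_memPn (notin_left b _)).
by rewrite code_cons_absent ?(valP a) ?(valP b).
Qed.

(** Within each block the letters of [G] precede those of [G'], so the trace is a run of [true]
    followed by a run of [false], as [cycle_blocks] requires. *)
Lemma cyclic_alternate_interleave (a : {x : G | x != m}) (b : {y : G' | y != m'}) :
  sumn (map (count_mem (val a)) As) = size As ->
  sumn (map (count_mem (val b)) Bs) = size Bs ->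
  cyclic_alternate (inl a) (inr b) (interleave As Bs)
  = all (pred1 1) (map (count_mem (val a)) As)
    && all (pred1 1) (map (count_mem (val b)) Bs).
Proof.
move=> sumA sumB.
pose ps := [seq (count_mem (val a) p.1, count_mem (val b) p.2) | p <- zip As Bs].
have ps1 : unzip1 ps = map (count_mem (val a)) As.
  by rewrite /unzip1 -map_comp -map_zip_left.
have ps2 : unzip2 ps = map (count_mem (val b)) Bs.
  by rewrite /unzip2 -map_comp -map_zip_right.
have size_ps : size ps = size As by rewrite size_map size_zip sizeAB minnn.
rewrite -ps1 -ps2 -cycle_blocks ?ps1 ?ps2 ?size_ps ?sumB //.
rewrite /cyclic_alternate code_flatten -!map_comp; congr (cycle _ (flatten _)).
apply: eq_map => p /=; rewrite code_cat.
rewrite (code_absent_right _ (notin_left b _)) (code_absent_left _ (notin_right a _)).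
by rewrite (count_pmap _ (left_letterE a)) (count_pmap _ (right_letterE b)).
Qed.

End Interleaving.

Theorem theorem1 (k : nat) (G G' : sgraph) (m : G) (m' : G') :
  1 <= k ->
  connected G -> connected G' ->
  k_word_representable k G -> k_word_representable k G' ->
  k_word_representable k (split_recomposition m m').
Proof.
move=> k_gt0 _ _ /(factored_word m)[As [AsN szA sumA adjA]].
move=> /(factored_word m')[Bs [BsN szB sumB adjB]].
have szAB : size As = size Bs by rewrite szA szB.
pose w : seq (split_recomposition m m') := interleave m m' As Bs.
have unif : uniform k w.
  move=> [a|b]; first by rewrite /w count_interleave_left ?sumA ?(valP a).
  by rewrite /w count_interleave_right ?sumB ?(valP b).
have cross a b : adj (inl a : split_recomposition m m') (inr b)
    = cyclic_alternate (inl a) (inr b) w.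
  have [am bm] := (valP a, valP b).
  rewrite /w cyclic_alternate_interleave ?szA ?szB ?sumA ?sumB //=.
  (* Adjacency to a marked vertex also unfolds to occurring once in every factor, so both sides
     become the same condition. *)
  rewrite !inE adjA 1?eq_sym // adjB 1?eq_sym //.
  by rewrite !cyclic_alternate_factors ?szA ?szB ?sumA ?sumB.
have repr (x y : split_recomposition m m') : x != y ->
    alternate w x y <-> cyclic_alternate x y w.
  by move=> xy; apply: alternateP => //; rewrite !unif.
exists w; split=> //; split=> [x | x y xy]; first by rewrite -has_pred1 has_count unif.
have -> : adj x y = cyclic_alternate x y w; last exact: iff_sym (repr x y xy).
case: x y xy => [a|b] [a'|b'] xy.
- by rewrite /cyclic_alternate code_interleave_left // -/(cyclic_alternate _ _ _) -adjA.
- exact: cross.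
(* The symmetry of [cyclic_alternate] is borrowed from that of [alternate] through [repr]. *)
- rewrite adj_sym cross; have yx := xy; rewrite eq_sym in yx.
  by apply/idP/idP => [/(repr _ _ yx)|/(repr _ _ xy)] /alternate_sym;
    [move/(repr _ _ xy)|move/(repr _ _ yx)].
- by rewrite /cyclic_alternate code_interleave_right // -/(cyclic_alternate _ _ _) -adjB.
Qed.
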